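(* Let $(X,d,\mu)$ be an irreversible metric measure space which has exponential concentration, i.e. there are positive constants $C$ and $c$ such that $\alpha_{(X,d,\mu)}(r)\le Ce^{-cr}$ for every $r>0$. Then, for $q\ge 1$, $(X,d,\mu)$ satisfies $(1,q)$-Moment concentration.
   Context: An irreversible metric space $(X,d)$ is a set $X$ with a function $d:X\times X\to[0,\infty)$ such that $d(x_1,x_2)=0$ if and only if $x_1=x_2$, and $d(x_1,x_3)\le d(x_1,x_2)+d(x_2,x_3)$ for all $x_1,x_2,x_3\in X$ ($d$ need not be symmetric). An irreversible metric measure space $(X,d,\mu)$ is an irreversible metric space endowed with a Borel probability measure $\mu$. For $A\subset X$ and $r>0$ put $B^{+}(A,r)=\{x\in X\mid \inf_{z\in A}d(z,x)<r\}$ and $B^{-}(A,r)=\{x\in X\mid \inf_{z\in A}d(x,z)<r\}$. The concentration function is $$\alpha_{(X,d,\mu)}(r)=\sup\left\{1-\min\{\mu(B^{+}(A,r)),\mu(B^{-}(A,r))\}\;\middle|\; A\subset X \text{ Borel},\ \mu(A)\ge \tfrac12\right\},\quad r>0.$$ A function $f:X\to\mathbb{R}$ is $L$-Lipschitz ($L>0$) if $f(z)-f(x)\le L\,d(x,z)$ for all $x,z\in X$. The sets $B^{\pm}(A,r)$ and Lipschitz functions are understood to be measurable. Given $p,q\ge 1$, $(X,d,\mu)$ is said to satisfy $(p,q)$-Moment concentration if there is a positive constant $C$ such that for any 1-Lipschitz function $f$, $\left\|f-\int_X f\,d\mu\right\|_{L^q(\mu)}^p\le \frac{q}{C}$. 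*)

(* Defs.v *)
From HB Require Import structures.
From mathcomp Require Import all_boot all_order all_algebra.
From mathcomp Require Import all_classical all_reals all_analysis.

Set Implicit Arguments.
Unset Strict Implicit.
Unset Printing Implicit Defensive.

Import Order.TTheory GRing.Theory Num.Theory.
Import numFieldNormedType.Exports.

Local Open Scope classical_set_scope.
Local Open Scope ring_scope.

(* X with its Borel sigma-algebra. *)
Notation borelType X := (g_sigma_algebraType (@open X)).

Definition irreversible_metric (R : realType) (X : Type) (d : X -> X -> R) :
    Prop :=
  [/\ forall x y, 0 <= d x y,
      forall x y, d x y = 0 <-> x = y &
      forall x y z, d x z <= d x y + d y z].

(* The infimum is taken in \bar R, so that inf over the empty set is +oo and
   the neighborhoods of the empty set are empty. *)
Definition fwd_nbhd (R : realType) (X : Type) (d : X -> X -> R)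
    (A : set X) (r : R) : set X :=
  [set x | (ereal_inf [set (d z x)%:E | z in A] < r%:E)%E].

Definition bwd_nbhd (R : realType) (X : Type) (d : X -> X -> R)
    (A : set X) (r : R) : set X :=
  [set x | (ereal_inf [set (d x z)%:E | z in A] < r%:E)%E].

Definition irr_lipschitz (R : realType) (X : Type) (d : X -> X -> R)
    (L : R) (f : X -> R) : Prop :=
  forall x z, f z - f x <= L * d x z.

(* The standing convention tying the Borel structure of X to d. An asymmetric d
   induces several topologies (by forward balls, by backward balls, by the
   symmetrization of d), and none is privileged here: X carries any topology
   whose Borel sets satisfy this convention, as those three do. *)
Definition measurability_convention (R : realType) (X : ptopologicalType)
    (d : X -> X -> R) : Prop :=
  (forall (A : set (borelType X)) (r : R), measurable A -> 0 < r ->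
     measurable (fwd_nbhd d A r : set (borelType X)) /\
     measurable (bwd_nbhd d A r : set (borelType X))) /\
  (forall (L : R) (f : borelType X -> R), 0 < L -> irr_lipschitz d L f ->
     measurable_fun setT f).

Definition irreversible_mm_space (R : realType) (X : ptopologicalType)
    (d : X -> X -> R) (mu : probability (borelType X) R) : Prop :=
  irreversible_metric d /\ measurability_convention d.

Definition concentration_function (R : realType) (X : ptopologicalType)
    (d : X -> X -> R) (mu : probability (borelType X) R) (r : R) : \bar R :=
  ereal_sup [set (1 - Order.min (mu (fwd_nbhd d A r)) (mu (bwd_nbhd d A r)))%E
    | A in [set A : set (borelType X) |
              measurable A /\ ((2^-1)%:E <= mu A)%E]].

Definition exponential_concentration (R : realType) (X : ptopologicalType)
    (d : X -> X -> R) (mu : probability (borelType X) R) : Prop :=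
  exists C c : R, [/\ 0 < C, 0 < c &
    forall r : R, 0 < r ->
      (concentration_function d mu r <= (C * expR (- c * r))%:E)%E].

(* The inner integral is real-valued, with a default value when f is not
   integrable. This is harmless: mu being finite and 1 <= q, for a measurable
   non-integrable f the norm below is +oo whatever constant is subtracted, so
   the bound entails the integrability of f. *)
Definition moment_concentration (R : realType) (X : ptopologicalType)
    (d : X -> X -> R) (mu : probability (borelType X) R) (p q : R) : Prop :=
  exists2 C : R, 0 < C &
    forall f : borelType X -> R, irr_lipschitz d 1 f ->
      ((Lnorm mu q%:E (fun x => (f x - \int[mu]_y f y)%:E)) `^ p
         <= (q / C)%:E)%E.

(* Main.v *)
(** Let f be 1-Lipschitz and let m be a quasi-median: f <= m and f > m - 1 both
    have probability at least 1/2. By the Lipschitz condition the forward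
    r-neighborhood of {f <= m} lies in {f < m + r} and the backward
    r-neighborhood of {f > m - 1} lies in {f > m - 1 - r}, so exponential
    concentration gives |f - m| an exponential tail, uniformly in f. With
    a = c / 2, slicing by the integer part of |f - m| yields
    E exp(a |f - m|) <= M with M independent of f, hence |m - E f| <= M / a,
    and y^q <= (q / a)^q exp(a y) bounds the q-norm of f - E f by
    (q / a) e^M M. *)

Require Import Defs.
From HB Require Import structures.
From mathcomp Require Import all_boot all_order all_algebra.
From mathcomp Require Import all_classical all_reals all_analysis.
From mathcomp Require Import measurable_realfun ring lra.

Set Implicit Arguments.
Unset Strict Implicit.
Unset Printing Implicit Defensive.

Import Order.TTheory GRing.Theory Num.Theory.
Import numFieldNormedType.Exports.

Local Open Scope classical_set_scope.
Local Open Scope ring_scope.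

(** Walking from a point where the cdf is below [p] in steps of [e], the first grid point where it
    reaches [p] serves as [m]; the limits of the cdf at both infinities make the walk start and
    stop. For [p = 1/2] and [e = 1] this is the quasi-median. *)
Lemma cdf_jump_exists d (T : measurableType d) (R : realType)
    (P : probability T R) (X : {RV P >-> R}) (p e : R) :
  0 < p < 1 -> 0 < e ->
  exists m : R, (p%:E <= cdf X m)%E /\ (cdf X (m - e) < p%:E)%E.
Proof.
move=> /andP[p0 p1] e0.
have [t0 ht0] : exists t, (cdf X t < p%:E)%E.
  have [M [_ hM]] := cvg_cdfNy0 X (nbhs_open_ereal_lt (f := fun=> p) p0).
  by exists (M - 1); apply: hM; rewrite ltrBlDr ltrDl.
have [t1 ht1] : exists t, (p%:E <= cdf X t)%E.
  have [M [_ hM]] := cvg_cdfy1 X (nbhs_open_ereal_gt (f := fun=> p) p1).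
  by exists (M + 1); apply/ltW/hM; rewrite ltrDl.
have ex_n : exists n : nat, (p%:E <= cdf X (t0 + n%:R * e))%E.
  exists (Num.truncn ((t1 - t0) / e)).+1.
  rewrite (le_trans ht1)// cdf_nondecreasing// -lerBlDl -ler_pdivrMr//.
  exact/ltW/truncnS_gt.
(* The least index is not 0, since the cdf at [t0] is below [p]; hence its predecessor is a grid
   point and fails by minimality. *)
case: (ex_minnP ex_n) => -[|n] hn n_min.
  by move: ht0; rewrite ltNge -[t0]addr0 -(mul0r e) hn.
exists (t0 + n.+1%:R * e); split => //.
rewrite (_ : _ - e = t0 + n%:R * e); last by rewrite -natr1; ring.
by rewrite ltNge; apply/negP => /n_min; rewrite ltnn.
Qed.

(** Where [n <= g < n + 1], the integrand is at most [expR (a * (n + 1))]. Integrating these bounds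
    over the tails gives a geometric series with first term [K * expR a] and ratio [expR (a - c)],
    which is below 1 because [a < c]. *)
Lemma integral_expR_le_tail d (T : measurableType d) (R : realType)
    (mu : {measure set T -> \bar R}) (g : T -> R) (K a c : R) :
  measurable_fun setT g -> (forall x, 0 <= g x) -> 0 <= a < c ->
  (forall n : nat, (mu [set x | (n%:R <= g x)%R]
     <= (K * expR (- c * n%:R))%:E)%E) ->
  (\int[mu]_x (expR (a * g x))%:E
     <= (K * expR a / (1 - expR (a - c)))%:E)%E.
Proof.
move=> mg g0 /andP[a0 ac] tail.
pose A n : set T := [set x | n%:R <= g x].
have mA n : measurable (A n).
  rewrite -[A n]setTI; have := mg measurableT `[n%:R, +oo[%classic.
  rewrite (_ : g @^-1` _ = A n); first exact.
  by apply/seteqP; split => x /=; rewrite in_itv/= andbT.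
(* The indicator is that of the whole tail [n <= g], not of the slice: this overcounts, but fits the
   tail hypothesis directly. *)
pose F n x : \bar R := (expR (a * n.+1%:R) * \1_(A n) x)%:E.
have F0 n x : (0 <= F n x)%E by rewrite lee_fin mulr_ge0 ?expR_ge0.
have mF n : measurable_fun setT (F n).
  by apply/measurable_EFinP/measurable_funM => //; exact: measurable_indic.
have z1 : `|expR (a - c)| < 1.
  by rewrite ger0_norm ?expR_ge0// expR_lt1 subr_lt0.
apply: (@le_trans _ _ (\int[mu]_x \sum_(0 <= n <oo) F n x)%E).
  apply: ge0_le_integral => //.
  - apply/measurable_EFinP; apply: measurableT_comp => //.
    exact: measurable_funM.
  - exact: ge0_emeasurable_sum.
  (* The single term at the integer part of [g x] already dominates the integrand. *)
  move=> x _; set N := Num.truncn (g x).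
  apply: (@le_trans _ _ (F N x)).
    have AN : x \in A N by rewrite inE /A /= truncn_le.
    rewrite lee_fin indicE AN mulr1 ler_expR ler_wpM2l//.
    exact/ltW/truncnS_gt.
  apply: le_trans (nneseries_lim_ge N.+1 _) => //.
  by rewrite big_nat_recr//= leeDr// sume_ge0.
rewrite integral_nneseries//.
apply: (@le_trans _ _
    (\sum_(0 <= n <oo) (geometric (K * expR a) (expR (a - c)) n)%:E)%E).
  apply: lee_nneseries => [n _ _|n _]; first exact: integral_ge0.
  rewrite /F.
  under eq_integral do rewrite EFinM.
  rewrite ge0_integralZl_EFin ?expR_ge0//; last first.
    by apply/measurable_EFinP; exact: measurable_indic.
  rewrite integral_indic// setIT.
  apply: (@le_trans _ _ ((expR (a * n.+1%:R))%:E
    * (K * expR (- c * n%:R))%:E)%E).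
    by apply: lee_wpmul2l; [rewrite lee_fin expR_ge0|exact: tail].
  rewrite -EFinM lee_fin /geometric /= -expRM_natr mulrCA -mulrA -!expRD.
  rewrite le_eqVlt; apply/orP; left; apply/eqP; congr (_ * expR _).
  by rewrite -natr1; ring.
under eq_fun do rewrite sumEFin.
rewrite EFin_lim ?lee_fin; last exact: is_cvg_geometric_series.
by have /cvg_lim -> := cvg_geometric_series (a := K * expR a) z1.
Qed.

(** This is [t <= expR t] at [t = a * y / q], raised to the power [q]. *)
Lemma powR_le_expR (R : realType) (q a y : R) : 0 < q -> 0 < a -> 0 <= y ->
  y `^ q <= (q / a) `^ q * expR (a * y).
Proof.
move=> q0 a0 y0.
have y_le : y <= q / a * expR (a * y / q).
  have yE : y = q / a * (a * y / q) by field; rewrite !gt_eqF.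
  rewrite {1}yE ler_pM2l ?divr_gt0//.
  by apply: le_trans (expR_ge1Dx _); rewrite lerDr.
have -> : a * y = (a * y / q) * q by field; rewrite gt_eqF.
rewrite expRM -powRM ?expR_ge0 ?divr_ge0 ?(ltW q0) ?(ltW a0)//.
apply: (ge0_ler_powR (ltW q0)) => //.
by rewrite nnegrE mulr_ge0 ?divr_ge0 ?expR_ge0 ?(ltW q0) ?(ltW a0).
Qed.

Lemma Lnorm_center_le d (T : measurableType d) (R : realType)
    (mu : probability T R) (f : T -> R) (m a M q : R) :
  measurable_fun setT f -> 0 < a -> 1 <= q ->
  (\int[mu]_x (expR (a * `|f x - m|))%:E <= M%:E)%E ->
  (Lnorm mu q%:E (fun x => (f x - \int[mu]_y f y)%:E)
     <= (q / a * (expR M * M))%:E)%E.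
Proof.
move=> mf a0 q1 hM.
have q0 : 0 < q by exact: lt_le_trans q1.
have mfm : measurable_fun setT (fun x => `|f x - m|).
  by apply: measurableT_comp => //; exact: measurable_funB.
have mE : measurable_fun setT (fun x => (expR (a * `|f x - m|))%:E).
  apply/measurable_EFinP; apply: measurableT_comp => //.
  exact: measurable_funM.
(* The integrand is at least 1 and [mu] has mass 1. This is what later lets the exponent [q^-1] be
   dropped. *)
have M1 : 1 <= M.
  rewrite -lee_fin; apply: le_trans hM.
  rewrite -[leLHS](@probability_setT _ _ _ mu) -[leLHS]mul1e -integral_cst//.
  apply: ge0_le_integral => // x _.
  by rewrite lee_fin -expR0 ler_expR mulr_ge0// ltW.
have iE : mu.-integrable setT (fun x => (expR (a * `|f x - m|))%:E).
  apply/integrableP; split => //.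
  under eq_integral do rewrite gee0_abs ?lee_fin ?expR_ge0//.
  exact: le_lt_trans hM (ltry _).
(* Domination by [a^-1 * expR (a * |f - m|)]. It makes [f] integrable, so [\int[mu]_y f y] is the
   true mean and not a default value. *)
have ifm : mu.-integrable setT (fun x => (f x - m)%:E).
  apply: (le_integrable _ _ _ (integrableZl measurableT a^-1 iE)) => //.
    by apply/measurable_EFinP; exact: measurable_funB.
  move=> x _ /=; rewrite lee_fin [leRHS]ger0_norm
    ?mulr_ge0 ?invr_ge0 ?expR_ge0 ?(ltW a0) ?(ltW q0)//.
  rewrite mulrC ler_pdivlMr// mulrC.
  by apply: le_trans (expR_ge1Dx _); rewrite lerDr.
have im : mu.-integrable setT (fun=> m%:E).
  by apply: finite_measure_integrable_cst.
have i_f : mu.-integrable setT (EFin \o f).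
  have := integrableD measurableT ifm im.
  by apply: eq_integrable => // x _ /=; rewrite -EFinD subrK.
have center : `|m - \int[mu]_y f y| <= M / a.
  have -> : m - \int[mu]_y f y = - \int[mu]_y (f y - m).
    rewrite RintegralB// Rintegral_cst//
      [X in fine X](@probability_setT _ _ _ mu) mulr1.
    by rewrite opprB.
  rewrite normrN (le_trans (le_normr_Rintegral _ _))//.
  rewrite ler_pdivlMr// mulrC -lee_fin.
  apply: le_trans hM.
  rewrite EFinM /Rintegral fineK; last first.
    apply: integrable_fin_num => //.
    exact: (integrable_norm ifm).
  rewrite -ge0_integralZl_EFin ?(ltW a0) ?(ltW q0)//;
    last exact/measurable_EFinP.
  apply: ge0_le_integral => //.
  - by move=> x _; rewrite mule_ge0 ?lee_fin// ltW.
  - by apply/measurable_EFinP; exact: measurable_funM.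
  - move=> x _; rewrite -EFinM lee_fin.
    by apply: le_trans (expR_ge1Dx _); rewrite lerDr.
set I := \int[mu]_y f y in center *.
(* Moving the center from [m] to the mean adds at most [M / a] to the deviation, which costs a
   factor [expR (a * (M / a)) = expR M]. *)
have powR_bound x :
  `|f x - I| `^ q <= (q / a) `^ q * expR M * expR (a * `|f x - m|).
  apply: (le_trans (powR_le_expR q0 a0 (normr_ge0 _))).
  rewrite -mulrA ler_wpM2l ?powR_ge0// -expRD ler_expR.
  rewrite (_ : M = a * (M / a)); last by field; rewrite gt_eqF.
  rewrite -mulrDr ler_wpM2l ?(ltW a0) ?(ltW q0)//.
  apply: (@le_trans _ _ (`|m - I| + `|f x - m|)); last by rewrite lerD2r.
  by rewrite (le_trans _ (ler_normD _ _))// [X in _ <= `|X|]addrC addrA subrK.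
have B0 : 0 <= (q / a) `^ q * expR M by rewrite mulr_ge0 ?powR_ge0 ?expR_ge0.
have eM1 : 1 <= expR M * M.
  by rewrite (le_trans M1)// ler_peMl ?(le_trans ler01)//
    -expR0 ler_expR (le_trans ler01).
rewrite unlock.
apply: (@le_trans _ _ (((q / a) `^ q * (expR M * M))%:E `^ q^-1)%E).
  apply: gt0_ler_poweR; rewrite ?invr_ge0 ?(ltW a0) ?(ltW q0)//.
  - by rewrite in_itv/= leey andbT integral_ge0// => x _; exact: poweR_ge0.
  - by rewrite in_itv/= leey andbT lee_fin mulr_ge0 ?powR_ge0//
      (le_trans ler01).
  rewrite mulrA EFinM.
  apply: (@le_trans _ _ (((q / a) `^ q * expR M)%:E *
     \int[mu]_x (expR (a * `|f x - m|))%:E)%E); last by rewrite lee_wpmul2l.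
  rewrite -ge0_integralZl_EFin//.
  apply: ge0_le_integral => //.
  - by move=> x _; exact: poweR_ge0.
  - apply: (measurableT_comp (measurable_poweR _)).
    apply: measurableT_comp => //; apply/measurable_EFinP.
    exact: measurable_funB.
  - exact: measurable_funeM.
  - by move=> x _; rewrite /= -EFinM lee_fin.
rewrite poweR_EFin lee_fin powRM ?powR_ge0 ?(le_trans ler01)//.
rewrite -powRrM mulfV ?gt_eqF// powRr1 ?divr_ge0 ?(ltW a0) ?(ltW q0)//.
rewrite ler_wpM2l ?divr_ge0 ?(ltW a0) ?(ltW q0)//.
rewrite -[leRHS]powRr1 ?(le_trans ler01)// ler_powR//.
by rewrite invf_le1.
Qed.

Lemma measure_setC_nbhd_le (R : realType) (X : ptopologicalType)
    (d : X -> X -> R) (mu : probability (borelType X) R)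
    (A : set (borelType X)) (r : R) :
  measurability_convention d -> measurable A -> ((2^-1)%:E <= mu A)%E ->
  0 < r ->
  (mu (~` fwd_nbhd d A r) <= concentration_function d mu r)%E /\
  (mu (~` bwd_nbhd d A r) <= concentration_function d mu r)%E.
Proof.
move=> [mnbhd _] mA A2 r0.
have [mF mB] := mnbhd A r mA r0.
have sup_ge : (1 - Order.min (mu (fwd_nbhd d A r)) (mu (bwd_nbhd d A r))
    <= concentration_function d mu r)%E.
  by apply: ereal_sup_ubound; exists A.
rewrite !probability_setC//.
by split; apply: le_trans sup_ge; rewrite leeB// ge_min lexx ?orbT.
Qed.

(** In the constant, [2 * C] collects the two one-sided tails, [expR c] pays for the radius [n - 1]
    used in place of [n], and the summand 1 covers [n <= 1]. *)
Lemma lipschitz_exp_tail (R : realType) (X : ptopologicalType)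
    (d : X -> X -> R) (mu : probability (borelType X) R) (C c : R)
    (f : borelType X -> R) :
  0 < C -> 0 < c -> measurability_convention d ->
  (forall r : R, 0 < r ->
    (concentration_function d mu r <= (C * expR (- c * r))%:E)%E) ->
  irr_lipschitz d 1 f ->
  exists m : R, forall n : nat,
    (mu [set x | (n%:R <= `|f x - m|)%R]
       <= (expR c * (1 + 2 * C) * expR (- c * n%:R))%:E)%E.
Proof.
move=> C0 c0 mconv conc lip.
have mf : measurable_fun setT f by apply: mconv.2 lip.
pose Y : {RV mu >-> R} := HB.pack f (isMeasurableFun.Build _ _ _ _ f mf).
have [||m [cdf_m cdf_m1]] := @cdf_jump_exists _ _ _ mu Y 2^-1 1; [lra|lra|].
exists m => n.
have mpre (B : set R) : measurable B -> measurable (f @^-1` B).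
  by move=> mB; rewrite -[_ @^-1` _]setTI; exact: (mf measurableT).
have mdev : measurable [set x | n%:R <= `|f x - m|].
  have : measurable_fun setT (fun x => `|f x - m|).
    by apply: measurableT_comp => //; exact: measurable_funB.
  move=> /(_ measurableT `[n%:R, +oo[%classic (measurable_itv _)).
  rewrite setTI; congr measurable.
  by apply/seteqP; split => x /=; rewrite in_itv/= andbT.
(* For [n <= 1] the radius [n - 1] is not positive; there the bound is at least 1, so it holds
   trivially. *)
have [n_le1|n_gt1] := leqP n 1.
  rewrite (le_trans (probability_le1 _ _))// lee_fin mulrAC -expRD.
  rewrite -[leLHS]mul1r ler_pM//; last by rewrite lerDl mulr_ge0// ltW.
  rewrite -[leLHS]expR0 ler_expR mulNr -{1}(mulr1 c) -mulrBr
    mulr_ge0 ?(ltW c0)//.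
  by rewrite subr_ge0 (ler_nat R n 1).
set r : R := n%:R - 1.
have r0 : 0 < r by rewrite subr_gt0 ltr1n.
pose A := f @^-1` `]-oo, m]; pose A' := f @^-1` `]m - 1, +oo[.
have mA : measurable A by exact: mpre.
have mA' : measurable A' by exact: mpre.
have hA' : ((2^-1)%:E <= mu A')%E.
  have -> : A' = ~` (f @^-1` `]-oo, m - 1]).
    apply/seteqP; split => x; rewrite /A' /= !in_itv /= andbT ltNge.
      by move/negP.
    by move/negP.
  rewrite probability_setC; last exact: mpre.
  have : (1 - (2^-1)%:E <= 1 - cdf Y (m - 1))%E by rewrite leeB// ltW.
  by apply: le_trans; rewrite -EFinB lee_fin; lra.
have [up _] := measure_setC_nbhd_le mconv mA cdf_m r0.
have [_ down] := measure_setC_nbhd_le mconv mA' hA' r0.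
have mS : measurable (~` fwd_nbhd d A r : set (borelType X)).
  by apply: measurableC; have [] := mconv.1 A r mA r0.
have mS' : measurable (~` bwd_nbhd d A' r : set (borelType X)).
  by apply: measurableC; have [] := mconv.1 A' r mA' r0.
(* An infimum below [r] is attained up to slack by some [z] in the set at distance less than [r].
   The forward case uses [d z x] and bounds [f x] above; the backward case uses [d x z] and bounds
   [f x] below, where the gap 1 of the quasi-median uses up exactly the unit lost in [r]. *)
have sub : [set x | n%:R <= `|f x - m|]
    `<=` ~` fwd_nbhd d A r `|` ~` bwd_nbhd d A' r.
  move=> x /=; rewrite ler_normr => /orP[fx|fx]; [left|right].
    move=> /ereal_inf_lt[_ [z Az <-]]; rewrite lte_fin => dzx.
    move: Az; rewrite /A /= in_itv /= => fz.
    by have := lip z x; move: fx dzx; rewrite /r; lra.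
  move=> /ereal_inf_lt[_ [z Az <-]]; rewrite lte_fin => dxz.
  move: Az; rewrite /A' /= in_itv /= andbT => fz.
  by have := lip x z; move: fx dxz; rewrite /r; lra.
apply: (@le_trans _ _ (mu (~` fwd_nbhd d A r `|` ~` bwd_nbhd d A' r))).
  by apply: le_measure; rewrite ?inE//; exact: measurableU.
apply: (le_trans (measureU2 _ mS mS')).
apply: (le_trans (leeD (le_trans up (conc _ r0)) (le_trans down (conc _ r0)))).
rewrite -EFinD lee_fin mulrAC -expRD.
have -> : - c * r = c + - c * n%:R by rewrite /r; ring.
have := expR_gt0 (c + - c * n%:R); set E := expR _ => E0.
by rewrite mulrDr mulr1 (_ : C * E + C * E = E * (2 * C)) ?lerDr ?ltW//; ring.
Qed.

Theorem theorem3p10 (R : realType) (X : ptopologicalType) (d : X -> X -> R)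
    (mu : probability (borelType X) R)
    (hX : irreversible_mm_space d mu)
    (hexp : exponential_concentration d mu)
    (q : R) (hq : 1 <= q) :
  moment_concentration d mu 1 q.
Proof.
have [_ mconv] := hX; have [C [c [C0 c0 conc]]] := hexp.
pose a := c / 2.
have a0 : 0 < a by rewrite divr_gt0.
have ac : a < c by rewrite /a; lra.
(* The exponential moment bound for the tail constant [expR c * (1 + 2 * C)]; it depends only on [C]
   and [c], which makes the final constant uniform in [f]. *)
pose M := expR c * (1 + 2 * C) * expR a / (1 - expR (a - c)).
have M0 : 0 < M.
  rewrite divr_gt0 ?subr_gt0 ?expR_lt1 ?subr_lt0// !mulr_gt0 ?expR_gt0//.
  by rewrite addr_gt0// mulr_gt0.
exists (a / (expR M * M)); first by rewrite divr_gt0// mulr_gt0// expR_gt0.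
move=> f lip; rewrite poweRe1 ?Lnorm_ge0//.
have mf : measurable_fun setT f by apply: mconv.2 lip.
have [m tail] := lipschitz_exp_tail C0 c0 mconv conc lip.
have -> : q / (a / (expR M * M)) = q / a * (expR M * M).
  by rewrite invf_div mulrCA mulrC.
apply: (Lnorm_center_le (m := m)) => //.
apply: integral_expR_le_tail tail => //.
  by apply: measurableT_comp => //; exact: measurable_funB.
by rewrite ltW.
Qed.
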